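(* Let $(\mu_0^\varepsilon)_{\varepsilon>0}$ be a collection of exponentially tight Borel probability measures on a Banach space $\mathcal B$ satisfying a large deviations principle, with speed $\varepsilon^2$ as $\varepsilon\to0$, with good rate function $I_0:\mathcal B\to[0,\infty]$. Consider functions $F^\varepsilon:\mathcal B\to\mathbb R$ ($\varepsilon>0$) and suppose that they satisfy, for an integer $n\ge1$, the expansion $$F^\varepsilon(y)=F_0(y)+\varepsilon F_1(y)+\frac{\varepsilon^2}{2}F_2(y)+\dots+\frac{\varepsilon^n}{n!}F_n(y)+\varepsilon^nR_n(\varepsilon,y)$$ for some functions $F_i:\mathcal B\to\mathbb R$, $0\le i\le n$, and $R_n:(0,\infty)\times\mathcal B\to\mathbb R$ with $\lim_{\varepsilon\to0}R_n(\varepsilon,y)=0$ for every $y\in\mathcal B$. Suppose that $F_0$ is continuous. Furthermore, assume that for each $0\le i\le n$ there is $\gamma_i>0$ with $$\limsup_{\varepsilon\to0}\varepsilon^2\log E_{\mu_0^\varepsilon}\left[\exp\left(\gamma_i\frac{\max\{|F_i(y)|,|R_n(\varepsilon,y)|\}}{\varepsilon^2}\right)\right]<\infty.$$ Define the measures equivalent to $\mu_0^\varepsilon$ by $$\mu^\varepsilon=\frac{1}{E_{\mu_0^\varepsilon}\left[\exp\left(-\frac1{\varepsilon^2}F^\varepsilon(y)\right)\right]}\exp\left(-\frac1{\varepsilon^2}F^\varepsilon(y)\right)\mu_0^\varepsilon$$ (the normalizing constants being assumed finite). Assume that the measures $\mu^\varepsilon$ are exponentially tight. Then $\mu^\varepsilon$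 satisfies a large deviations principle, with speed $\varepsilon^2$ as $\varepsilon\to0$, with good rate function $$I(y):=I_0(y)+F_0(y)-\inf_{z\in\mathcal B}\{F_0(z)+I_0(z)\}.$$
   Context: A family $(\nu^\varepsilon)$ of Borel probability measures satisfies a large deviations principle with speed $\varepsilon^2$ and rate function $I$ if $I$ is lower semicontinuous, $\limsup_{\varepsilon\to0}\varepsilon^2\log\nu^\varepsilon(C)\le-\inf_CI$ for all closed $C$, and $\liminf_{\varepsilon\to0}\varepsilon^2\log\nu^\varepsilon(O)\ge-\inf_OI$ for all open $O$; the rate function is good if its sublevel sets $\{I\le t\}$ are compact. The family is exponentially tight (with speed $\varepsilon^2$) if for every $M<\infty$ there is a compact $K_M$ with $\limsup_{\varepsilon\to0}\varepsilon^2\log\nu^\varepsilon(K_M^c)<-M$. The functions $F_i$, $R_n(\varepsilon,\cdot)$ are Borel measurable. *)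

(* Defs.v *)
From HB Require Import structures.
From mathcomp Require Import all_boot all_order all_algebra.
From mathcomp Require Import all_classical all_reals all_analysis.

Set Implicit Arguments.
Unset Strict Implicit.
Unset Printing Implicit Defensive.

Import Order.TTheory GRing.Theory Num.Theory.
Import numFieldNormedType.Exports.

Local Open Scope classical_set_scope.
Local Open Scope ring_scope.
Local Open Scope ereal_scope.

Notation borel T := (g_sigma_algebraType (@open T)).

(* Families indexed by eps > 0 are functions on R: every limit is taken along
   0^'+, so the values at eps <= 0 play no role.  [lne] is the logarithm on
   \bar R, with lne 0 = -oo and lne +oo = +oo; [ereal_inf set0] is +oo. *)

Section large_deviations.
Context {R : realType} {T : ptopologicalType}.
Implicit Types (nu : R -> probability (borel T) R) (I : T -> \bar R).

Definition ldp nu I :=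
  [/\ lower_semicontinuous I,
      forall C : set T, closed C ->
        limf_esup (fun eps : R => (eps ^+ 2)%:E * lne (nu eps C)) 0^'+
          <= - ereal_inf (I @` C)
    & forall O : set T, open O ->
        - ereal_inf (I @` O)
          <= limf_einf (fun eps : R => (eps ^+ 2)%:E * lne (nu eps O)) 0^'+].

Definition good_rate_function I := forall t : R, compact [set y | I y <= t%:E].

Definition exponentially_tight nu := forall M : R,
  exists2 K : set T, compact K &
    limf_esup (fun eps : R => (eps ^+ 2)%:E * lne (nu eps (~` K))) 0^'+
      < (- M)%:E.

End large_deviations.

Section tilting.
Context {R : realType} {d : measure_display} {T : measurableType d}.
Implicit Types (P : probability T R) (V : T -> R).

Definition normalizing_constant P V (eps : R) : \bar R :=
  'E_P[fun y => expR (- (V y / eps ^+ 2))].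

(* The measure with density exp (- V / eps^2) / Z with respect to P.  [fine]
   only reads the constant Z as a real number; it is meant to be used when Z
   is finite. *)
Definition tilted P V (eps : R) (A : set T) : \bar R :=
  (fine (normalizing_constant P V eps))^-1%:E *
    \int[P]_(y in A) (expR (- (V y / eps ^+ 2)))%:E.

End tilting.

(* Main.v *)
(* Write F for F^eps. Since |F - F_0| <= eps * sum_i max (|F_i|, |R_n|), the
   exponential moments, available for some gamma_i > 0 only, suffice to make
   the mu0-integral of exp (|F - F_0| / eps^2) over {|F - F_0| > delta} smaller
   than exp (L / eps^2) for every real L: there, the factor eps turns
   |F - F_0| into an arbitrarily small multiple of the maximum.
   Up to such negligible terms F may be replaced by F_0 +- delta, which gives
   the unnormalized lower bound on open sets, and the upper bound on closed
   sets where F_0 is bounded.  Exponential tightness of mu then reduces the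
   closed sets, and the normalizing constant, to compact sets, on which F_0 is
   bounded.  The compactness of the sublevel sets of I follows from the lower
   bound on complements of compact sets. *)

Require Import Defs.
From HB Require Import structures.
From mathcomp Require Import all_boot all_order all_algebra.
From mathcomp Require Import all_classical all_reals all_analysis.
From mathcomp Require Import measurable_realfun ring lra.

Set Implicit Arguments.
Unset Strict Implicit.
Unset Printing Implicit Defensive.

Import Order.TTheory GRing.Theory Num.Theory.
Import numFieldNormedType.Exports.

Local Open Scope classical_set_scope.
Local Open Scope ring_scope.

(** * Limits superior and inferior against eventual bounds *)

Section limf_bounds.
Context {R : realType} {T : choiceType} {X : filteredType T}.
Implicit Types (f : X -> \bar R) (F : set_system X) (c : \bar R).
Local Open Scope ereal_scope.

Lemma limf_esup_lt f F c : Filter F ->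
  limf_esup f F < c -> \forall x \near F, f x < c.
Proof.
move=> FF; rewrite limf_esupE => /ereal_inf_lt[_ [V FV <-]] Vc.
apply: (@filterS _ F FF _ _ _ FV) => x Vx; apply: le_lt_trans Vc.
by apply: ereal_sup_ubound; exists x.
Qed.

Lemma limf_esup_le f F c : Filter F ->
  (\forall x \near F, f x <= c) -> limf_esup f F <= c.
Proof.
move=> FF Ffc; rewrite limf_esupE; apply: ereal_inf_le.
exists (ereal_sup (f @` [set x | f x <= c])).
  by exists [set x | f x <= c].
by apply: ge_ereal_sup => _ [x /= fx <-].
Qed.

Lemma limf_einf_gt f F c : Filter F ->
  c < limf_einf f F -> \forall x \near F, c < f x.
Proof.
move=> FF; rewrite /limf_einf lteNr => /limf_esup_lt.
by apply: (@filterS _ F FF) => x; rewrite lteN2.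
Qed.

Lemma limf_einf_ge f F c : Filter F ->
  (\forall x \near F, c <= f x) -> c <= limf_einf f F.
Proof.
move=> FF Fcf; rewrite /limf_einf leeNr; apply: limf_esup_le.
by apply: (@filterS _ F FF _ _ _ Fcf) => x; rewrite leeN2.
Qed.

End limf_bounds.

(** * Calculus of exponential rates at speed [eps ^+ 2] *)

Section exponential_rates.
Context {R : realType}.
Implicit Types (f g : R -> \bar R) (a b c : R).

(** A rate bound stated as an eventual inequality can be added, multiplied and integrated directly;
    [lne] and the limits are met only on entering and on leaving this calculus. For nonnegative [f]
    it lies between limsup < c and limsup <= c, and letting the real [c] vary absorbs the
    difference. *)
Definition exp_le f c :=
  \forall eps \near 0^'+, (f eps <= (expR (c / eps ^+ 2))%:E)%E.

Definition exp_ge f c :=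
  \forall eps \near 0^'+, ((expR (c / eps ^+ 2))%:E <= f eps)%E.

Lemma near0_gt0 : \forall eps \near (0 : R)^'+, 0 < eps.
Proof. exact: nbhs_right_gt. Qed.

Lemma near0_expR_ge k d : 0 < d ->
  \forall eps \near (0 : R)^'+, k <= expR (d / eps ^+ 2).
Proof.
move=> d0; have k0 : 0 < `|k| + 1 by rewrite ltr_wpDl.
near=> eps.
have e0 : 0 < eps by near: eps; exact: near0_gt0.
have e1 : eps <= 1 by near: eps; apply: nbhs_right_ltW.
have ed : eps <= d / (`|k| + 1).
  by near: eps; apply: nbhs_right_ltW; rewrite divr_gt0.
apply: le_trans (expR_ge1Dx _); rewrite -[k]add0r lerD//.
have e2 : eps ^+ 2 <= d / (`|k| + 1).
  by apply: le_trans ed; rewrite expr2 ger_pMl.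
rewrite ler_pdivlMr ?exprn_gt0//.
rewrite ler_pdivlMr// in e2.
apply: le_trans e2; rewrite [k * _]mulrC; apply: ler_wpM2l.
  by rewrite exprn_ge0// ltW.
by rewrite (le_trans (ler_norm _))// lerDl.
Unshelve. all: by end_near. Qed.

Lemma ler_exp_rate a c eps : 0 < eps -> a <= c ->
  expR (a / eps ^+ 2) <= expR (c / eps ^+ 2).
Proof. by move=> e0 ac; rewrite ler_expR ler_wpM2r// invr_ge0 exprn_ge0// ltW. Qed.

Lemma exp_leW f a c : a <= c -> exp_le f a -> exp_le f c.
Proof.
move=> ac fa; near=> eps.
have e0 : 0 < eps by near: eps; exact: near0_gt0.
apply: (@le_trans _ _ (expR (a / eps ^+ 2))%:E); first by near: eps.
by rewrite lee_fin ler_exp_rate.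
Unshelve. all: by end_near. Qed.

Lemma exp_le_trans f g c : (\forall eps \near 0^'+, (f eps <= g eps)%E) ->
  exp_le g c -> exp_le f c.
Proof.
by move=> fg gc; near=> eps; apply: (@le_trans _ _ (g eps)); near: eps.
Unshelve. all: by end_near. Qed.

(** A constant factor is free at exponential scale: it is eventually below
    [expR ((c - a) / eps ^+ 2)]. *)
Lemma exp_leZ f k a c : 0 <= k -> a < c -> exp_le f a ->
  exp_le (fun eps => k%:E * f eps)%E c.
Proof.
move=> k0 ac fa; near=> eps.
have e0 : 0 < eps by near: eps; exact: near0_gt0.
apply: (@le_trans _ _ (k%:E * (expR (a / eps ^+ 2))%:E)%E).
  by apply: lee_wpmul2l; [rewrite lee_fin | near: eps].
have -> : c / eps ^+ 2 = (c - a) / eps ^+ 2 + a / eps ^+ 2.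
  by rewrite -mulrDl subrK.
rewrite -EFinM lee_fin expRD ler_wpM2r ?expR_ge0//.
by near: eps; apply: near0_expR_ge; rewrite subr_gt0.
Unshelve. all: by end_near. Qed.

Lemma exp_leD f g a c : a < c -> exp_le f a -> exp_le g a ->
  exp_le (fun eps => f eps + g eps)%E c.
Proof.
move=> ac fa ga.
suff : exp_le (fun eps => 2%:E * (expR (a / eps ^+ 2))%:E)%E c.
  apply: exp_le_trans; near=> eps.
  rewrite -EFinM mulr_natl mulr2n EFinD leeD//; near: eps; [exact: fa|exact: ga].
by apply: exp_leZ ac _ => //; apply: nearW.
Unshelve. all: by end_near. Qed.

Lemma exp_leM f a b : exp_le f a ->
  exp_le (fun eps => (expR (b / eps ^+ 2))%:E * f eps)%E (b + a).
Proof.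
apply: filterS => eps fa.
by rewrite mulrDl expRD EFinM lee_wpmul2l// lee_fin expR_ge0.
Qed.

Lemma exp_geM f a b : exp_ge f a ->
  exp_ge (fun eps => (expR (b / eps ^+ 2))%:E * f eps)%E (b + a).
Proof.
apply: filterS => eps fa.
by rewrite mulrDl expRD EFinM lee_wpmul2l// lee_fin expR_ge0.
Qed.

Lemma exp_ge_trans f g c : (\forall eps \near 0^'+, (g eps <= f eps)%E) ->
  exp_ge g c -> exp_ge f c.
Proof.
by move=> fg gc; near=> eps; apply: (@le_trans _ _ (g eps)); near: eps.
Unshelve. all: by end_near. Qed.

(** With [m] the larger of [b] and [c], the exponential of rate [a] eventually exceeds twice that of
    rate [m]: one copy pays for [g], the other is the remaining lower bound. *)
Lemma exp_ge_subr f g a b c : exp_ge f a -> exp_le g b -> b < a -> c < a ->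
  exp_ge (fun eps => f eps - g eps)%E c.
Proof.
move=> fa gb ba ca; set m := Num.max b c.
have ma : m < a by rewrite gt_max ba ca.
near=> eps.
have e0 : 0 < eps by near: eps; exact: near0_gt0.
have h1 : (expR (c / eps ^+ 2) <= expR (a / eps ^+ 2) - expR (b / eps ^+ 2)).
  rewrite lerBrDr; apply: (@le_trans _ _ (2 * expR (m / eps ^+ 2))).
    by rewrite mulr_natl mulr2n lerD// ler_exp_rate// le_max lexx ?orbT.
  have -> : a / eps ^+ 2 = (a - m) / eps ^+ 2 + m / eps ^+ 2.
    by rewrite -mulrDl subrK.
  rewrite expRD ler_wpM2r ?expR_ge0//.
  by near: eps; apply: near0_expR_ge; rewrite subr_gt0.
apply: (@le_trans _ _ ((expR (a / eps ^+ 2))%:E - (expR (b / eps ^+ 2))%:E)%E).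
  by rewrite -EFinB lee_fin.
by apply: leeB; near: eps.
Unshelve. all: by end_near. Qed.

(** The filter [0^'+] is proper, so both bounds hold at some common positive [eps]. *)
Lemma exp_ge_le f a c : exp_ge f a -> exp_le f c -> a <= c.
Proof.
move=> fa fc; suff : \forall eps \near (0 : R)^'+, a <= c.
  by move=> h; have [] := filter_ex h.
near=> eps.
have e0 : 0 < eps by near: eps; exact: near0_gt0.
have : ((expR (a / eps ^+ 2))%:E <= (expR (c / eps ^+ 2))%:E)%E.
  by apply: (@le_trans _ _ (f eps)); near: eps.
by rewrite lee_fin ler_expR ler_pM2r// invr_gt0 exprn_gt0.
Unshelve. all: by end_near. Qed.

(** The conventions for [lne] at 0 and +oo agree with both sides, so null sets and infinite
    integrals need no separate treatment. *)
Lemma mule_lne_le (x : \bar R) c eps : 0 < eps -> (0 <= x)%E ->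
  ((eps ^+ 2)%:E * lne x <= c%:E)%E = (x <= (expR (c / eps ^+ 2))%:E)%E.
Proof.
move=> e0 x0; have e2 : 0 < eps ^+ 2 by rewrite exprn_gt0.
rewrite -[(expR _)%:E]/(expeR (c / eps ^+ 2)%:E) -[x in RHS]lneK; last first.
  by rewrite in_itv /= x0 leey.
rewrite lee_expeR; case: (lne x) => [r| |].
- by rewrite -EFinM !lee_fin ler_pdivlMr// mulrC.
- by rewrite gt0_muley ?lte_fin// !leye_eq.
- by rewrite gt0_muleNy ?lte_fin// !leNye.
Qed.

Lemma mule_lne_ge (x : \bar R) c eps : 0 < eps -> (0 <= x)%E ->
  (c%:E <= (eps ^+ 2)%:E * lne x)%E = ((expR (c / eps ^+ 2))%:E <= x)%E.
Proof.
move=> e0 x0; have e2 : 0 < eps ^+ 2 by rewrite exprn_gt0.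
rewrite -[(expR _)%:E]/(expeR (c / eps ^+ 2)%:E) -[x in RHS]lneK; last first.
  by rewrite in_itv /= x0 leey.
rewrite lee_expeR; case: (lne x) => [r| |].
- by rewrite -EFinM !lee_fin ler_pdivrMr// mulrC.
- by rewrite gt0_muley ?lte_fin// !leey.
- by rewrite gt0_muleNy ?lte_fin// !leeNy_eq.
Qed.

Lemma limf_esup_exp_le f c : (forall eps, (0 <= f eps)%E) ->
  (limf_esup (fun eps : R => (eps ^+ 2)%:E * lne (f eps)) 0^'+ < c%:E)%E ->
  exp_le f c.
Proof.
move=> f0 /limf_esup_lt fc; near=> eps.
have e0 : 0 < eps by near: eps; exact: near0_gt0.
by rewrite -mule_lne_le// ltW//; near: eps.
Unshelve. all: by end_near. Qed.

Lemma exp_le_limf_esup f c : (forall eps, (0 <= f eps)%E) -> exp_le f c ->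
  (limf_esup (fun eps : R => (eps ^+ 2)%:E * lne (f eps)) 0^'+ <= c%:E)%E.
Proof.
move=> f0 fc; apply: limf_esup_le; near=> eps.
have e0 : 0 < eps by near: eps; exact: near0_gt0.
by rewrite mule_lne_le//; near: eps.
Unshelve. all: by end_near. Qed.

Lemma limf_einf_exp_ge f c : (forall eps, (0 <= f eps)%E) ->
  (c%:E < limf_einf (fun eps : R => (eps ^+ 2)%:E * lne (f eps)) 0^'+)%E ->
  exp_ge f c.
Proof.
move=> f0 /limf_einf_gt fc; near=> eps.
have e0 : 0 < eps by near: eps; exact: near0_gt0.
by rewrite -mule_lne_ge// ltW//; near: eps.
Unshelve. all: by end_near. Qed.

Lemma exp_ge_limf_einf f c : (forall eps, (0 <= f eps)%E) -> exp_ge f c ->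
  (c%:E <= limf_einf (fun eps : R => (eps ^+ 2)%:E * lne (f eps)) 0^'+)%E.
Proof.
move=> f0 fc; apply: limf_einf_ge; near=> eps.
have e0 : 0 < eps by near: eps; exact: near0_gt0.
by rewrite mule_lne_ge//; near: eps.
Unshelve. all: by end_near. Qed.

(** Lets the bounds of a large deviations principle be proved one real rate at a time, with a strict
    gap available each time. *)
Lemma lee_gt_EFin (x y : \bar R) :
  (forall c : R, (x < c%:E)%E -> (y <= c%:E)%E) -> (y <= x)%E.
Proof.
case: x => [r| |] xy; [|exact: leey|].
- by apply/lee_addgt0Pr => e e0; apply: xy; rewrite lte_fin ltrDl.
- case: y xy => [s| |] xy //.
  + by have := xy (s - 1)%R (ltNyr _); rewrite lee_fin => ?; exfalso; lra.
  + by have := xy 0%R (ltNyr _).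
Qed.

Lemma lee_lt_EFin (x y : \bar R) :
  (forall c : R, (c%:E < x)%E -> (c%:E <= y)%E) -> (x <= y)%E.
Proof.
move=> xy; rewrite -leeN2; apply: lee_gt_EFin => c; rewrite lteNl -EFinN => cx.
by rewrite leeNl -EFinN; exact: xy.
Qed.

End exponential_rates.

(** * Elementary bounds for integrals of nonnegative functions *)

Lemma ge0_integral_setU_le d (T : measurableType d) (R : realType)
    (P : {measure set T -> \bar R}) (A B : set T) (f : T -> \bar R) :
  measurable A -> measurable B -> measurable_fun setT f ->
  (forall x, 0 <= f x)%E ->
  (\int[P]_(x in A `|` B) f x <=
   \int[P]_(x in A) f x + \int[P]_(x in B) f x)%E.
Proof.
move=> mA mB mf f0; have -> : A `|` B = A `|` (B `\` A).
  by rewrite setUDr setDv setD0.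
have mBA : measurable (B `\` A) by exact: measurableD.
rewrite ge0_integral_setU//.
- rewrite leeD2l// ge0_subset_integral//.
  by apply: measurable_funTS; exact: mf.
- by apply: measurable_funTS; exact: mf.
- by apply/disj_setPS => x [Ax [_ /(_ Ax)]].
Qed.

Lemma ge0_integral_le_cst d (T : measurableType d) (R : realType)
    (P : {measure set T -> \bar R}) (A : set T) (f : T -> \bar R) (k : R) :
  measurable A -> measurable_fun setT f -> (forall x, 0 <= f x)%E ->
  (forall x, A x -> f x <= k%:E)%E -> (\int[P]_(x in A) f x <= k%:E * P A)%E.
Proof.
move=> mA mf f0 fk; rewrite -integral_cst//; apply: ge0_le_integral => //.
exact: measurable_funTS.
Qed.

Lemma ge0_integral_ge_cst d (T : measurableType d) (R : realType)
    (P : {measure set T -> \bar R}) (A : set T) (f : T -> \bar R) (k : R) :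
  measurable A -> measurable_fun setT f -> 0 <= k ->
  (forall x, A x -> k%:E <= f x)%E -> (k%:E * P A <= \int[P]_(x in A) f x)%E.
Proof.
move=> mA mf k0 fk; rewrite -integral_cst//; apply: ge0_le_integral => //.
exact: measurable_funTS.
Qed.

(** * Borel sets and continuous functions *)

Section borel_sets.
Context {R : realType} {T : ptopologicalType}.
Implicit Types A : set T.

Lemma open_borel A : open A -> measurable (A : set (borel T)).
Proof. exact: sub_sigma_algebra. Qed.

Lemma closed_borel A : closed A -> measurable (A : set (borel T)).
Proof.
by rewrite -openC => /open_borel/measurableC; rewrite setCK.
Qed.

Lemma continuous_borel (f : T -> R) :
  continuous f -> measurable_fun [set: borel T] (f : borel T -> R).
Proof.
move=> cf; apply: (measurability _ (RGenOpens.measurableE R)).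
move=> _ [_ [a [b ->]] <-]; rewrite setTI; apply: open_borel.
apply: open_comp; last exact: interval_open.
by move=> x _; exact: cf.
Qed.

Lemma measurable_superlevel d (U : measurableType d) (f : U -> R) (r : R) :
  measurable_fun [set: U] f -> measurable [set x | r < f x].
Proof.
move=> mf; have := mf measurableT `]r, +oo[%classic (measurable_itv _).
rewrite setTI; congr measurable; apply/seteqP; split=> x /=.
  by rewrite in_itv /= andbT.
by rewrite in_itv /= andbT.
Qed.

Lemma continuous_bounded_on (f : T -> R) A : continuous f -> compact A ->
  exists M, forall y, A y -> `|f y| <= M.
Proof.
move=> cf cA; have : compact (f @` A).
  by apply: continuous_compact => //; exact: continuous_subspaceT.
move=> /compact_bounded /pinfty_ex_gt0[M _ fM]; exists M => y Ay.
by apply: fM; exists y.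
Qed.

End borel_sets.

(** * Rates of quotients *)

Section exponential_quotients.
Context {R : realType}.
Implicit Types (f g Z : R -> \bar R) (a b : R).

(** The quotient is given through the product [Z eps * g eps], which avoids dividing in the extended
    reals. *)
Lemma exp_le_div f Z g a b : (forall eps, 0 <= g eps)%E ->
  (\forall eps \near 0^'+, (Z eps * g eps <= f eps)%E) ->
  exp_le f a -> exp_ge Z b -> exp_le g (a - b).
Proof.
move=> g0 Zgf fa Zb; near=> eps.
have -> : (a - b) / eps ^+ 2 = - (b / eps ^+ 2) + a / eps ^+ 2.
  by rewrite mulrBl addrC.
rewrite expRD expRN EFinM lee_pdivlMl ?expR_gt0//.
apply: (@le_trans _ _ (f eps)); last by near: eps.
apply: (@le_trans _ _ (Z eps * g eps)%E); last by near: eps.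
by rewrite lee_wpmul2r//; near: eps.
Unshelve. all: by end_near. Qed.

Lemma exp_ge_div f Z g a b : (forall eps, 0 <= g eps)%E ->
  (\forall eps \near 0^'+, (f eps <= Z eps * g eps)%E) ->
  exp_ge f a -> exp_le Z b -> exp_ge g (a - b).
Proof.
move=> g0 fZg fa Zb; near=> eps.
have -> : (a - b) / eps ^+ 2 = - (b / eps ^+ 2) + a / eps ^+ 2.
  by rewrite mulrBl addrC.
rewrite expRD expRN EFinM lee_pdivrMl ?expR_gt0//.
apply: (@le_trans _ _ (f eps)); first by near: eps.
apply: (@le_trans _ _ (Z eps * g eps)%E); first by near: eps.
by rewrite lee_wpmul2r//; near: eps.
Unshelve. all: by end_near. Qed.

End exponential_quotients.

(** * Unnormalized integrals for a potential exponentially close to a continuous one *)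

Section tilting_ldp.
Context {R : realType} {T : ptopologicalType}.
Variables (P : R -> probability (borel T) R) (I0 : T -> \bar R).
Variables (Phi : T -> R) (V : R -> T -> R).
Hypothesis I0_ge0 : forall y, (0 <= I0 y)%E.
Hypothesis P_ldp : ldp P I0.
Hypothesis Phi_cont : continuous Phi.
Hypothesis V_meas : forall eps, 0 < eps ->
  measurable_fun [set: borel T] (V eps : borel T -> R).

(** Superexponential closeness of [V] to [Phi]. The integrand controls the tilted mass of the bad
    set; being at least 1, it also controls its probability. *)
Hypothesis V_approx : forall d L : R, 0 < d ->
  exp_le (fun eps =>
    \int[P eps]_(y in [set y : borel T | (d < `|V eps y - Phi y|)%R])
    (expR (`|V eps y - Phi y| / eps ^+ 2))%:E)%E L.

Let bad (d eps : R) : set (borel T) := [set y | d < `|V eps y - Phi y|].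

Let f eps (y : borel T) : \bar R := (expR (- (V eps y / eps ^+ 2)))%:E.
Let G (A : set (borel T)) (eps : R) : \bar R := (\int[P eps]_(y in A) f eps y)%E.

Let dist_meas eps : 0 < eps ->
  measurable_fun [set: borel T] (fun y : borel T => `|V eps y - Phi y|).
Proof.
move=> e0; apply: measurableT_comp; first exact: normr_measurable.
by apply: measurable_funB; [exact: V_meas | exact: continuous_borel].
Qed.

Let bad_meas d eps : 0 < eps -> measurable (bad d eps).
Proof. by move=> e0; apply: measurable_superlevel; exact: dist_meas. Qed.

Let f_meas eps : 0 < eps -> measurable_fun setT (f eps).
Proof.
move=> e0; apply/measurable_EFinP; apply: measurableT_comp => //.
apply: measurableT_comp; first exact: oppr_measurable.
by apply: measurable_funM; [exact: V_meas | exact: measurable_cst].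
Qed.

Let f_ge0 eps y : (0 <= f eps y)%E.
Proof. by rewrite lee_fin expR_ge0. Qed.

Let expdist_meas eps : 0 < eps -> measurable_fun [set: borel T]
  (fun y : borel T => (expR (`|V eps y - Phi y| / eps ^+ 2))%:E).
Proof.
move=> e0; apply/measurable_EFinP; apply: measurableT_comp => //.
by apply: measurable_funM; [exact: dist_meas | exact: measurable_cst].
Qed.

Let P_bad d L : 0 < d -> exp_le (fun eps => P eps (bad d eps)) L.
Proof.
move=> d0; apply: exp_le_trans _ (V_approx L d0); near=> eps.
have e0 : 0 < eps by near: eps; exact: near0_gt0.
rewrite -[X in (X <= _)%E]mul1e; apply: ge0_integral_ge_cst => //.
- exact: bad_meas.
- exact: expdist_meas.
- move=> y _; rewrite lee_fin -expR0 ler_expR.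
  by rewrite divr_ge0// exprn_ge0// ltW.
Unshelve. all: by end_near. Qed.

(** Off the bad set [V] is at least [a - d], so the density is at most [expR ((d - a) / eps ^+ 2)]
    and [C] has probability of rate [- j]. On the bad set the density is at most
    [expR (- a / eps ^+ 2)] times the integrand of [V_approx]. *)
Let G_level (C : set T) a j c : closed C -> (forall y, C y -> a <= Phi y) ->
  (j%:E < ereal_inf (I0 @` C))%E -> - a - j < c -> exp_le (G C) c.
Proof.
move=> clC aPhi jC ajc; have mC := closed_borel clC.
have [_ Pcl _] := P_ldp.
(* This makes [d - a - j] the midpoint of [- a - j] and [c]; choosing [L = d - j] in [V_approx]
   gives both parts this common rate. *)
pose d := (c + a + j) / 2.
have d0 : 0 < d by rewrite /d; lra.
have PC : exp_le (fun eps => P eps C) (- j).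
  apply: limf_esup_exp_le => //; apply: le_lt_trans (Pcl _ clC) _.
  by rewrite EFinN lteN2.
have h1 := exp_leM (d - a) PC.
have h2 := exp_leM (- a) (V_approx (d - j) d0).
have := @exp_leD _ _ _ (d - a - j) c _ h1.
rewrite (_ : d - a - j = - a + (d - j)); last by ring.
move=> /(_ _ _ h2) h; apply: exp_le_trans _ (h _); last by rewrite /d; lra.
near=> eps.
have e0 : 0 < eps by near: eps; exact: near0_gt0.
have e2 : 0 < eps ^+ 2 by rewrite exprn_gt0.
have mb := bad_meas d e0.
rewrite /G -{1}(setUIDK C (bad d eps)) addeC.
apply: le_trans (ge0_integral_setU_le _ _ _ (f_meas e0) _) _ => //.
- exact: measurableI.
- exact: measurableD.
apply: leeD.
  rewrite -ge0_integralZl//; last first.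
    by apply: measurable_funTS; exact: expdist_meas.
  apply: (@le_trans _ _ (\int[P eps]_(y in C `&` bad d eps)
     ((expR (- a / eps ^+ 2))%:E *
      (expR (`|V eps y - Phi y| / eps ^+ 2))%:E))%E).
    apply: ge0_le_integral => //.
    - exact: measurableI.
    - by apply: measurable_funTS; exact: f_meas.
    - apply: measurable_funeM; apply: measurable_funTS; exact: expdist_meas.
    - move=> y [Cy _]; rewrite -EFinM -expRD lee_fin ler_expR -mulrDl -mulNr.
      rewrite ler_pM2r ?invr_gt0//.
      have := aPhi _ Cy; have := ler_norm (- (V eps y - Phi y)).
      by rewrite normrN; lra.
  apply: ge0_subset_integral => //.
  - exact: measurableI.
  - by apply: measurable_funeM; apply: measurable_funTS; exact: expdist_meas.
apply: (@le_trans _ _ ((expR ((d - a) / eps ^+ 2))%:E * P eps (C `\` bad d eps))%E).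
  apply: ge0_integral_le_cst => //.
  - exact: measurableD.
  - exact: f_meas.
  - move=> y [Cy /negP]; rewrite -leNgt lee_fin ler_expR -mulNr => Vd.
    rewrite ler_pM2r ?invr_gt0//.
    have := aPhi _ Cy; have := ler_norm (- (V eps y - Phi y)).
    by rewrite normrN; lra.
rewrite lee_wpmul2l ?lee_fin ?expR_ge0//.
by rewrite le_measure ?inE//; exact: measurableD.
Unshelve. all: by end_near. Qed.

Let G_setU_le (A B : set (borel T)) eps : 0 < eps -> measurable A -> measurable B ->
  (G (A `|` B) eps <= G A eps + G B eps)%E.
Proof. by move=> e0 mA mB; apply: ge0_integral_setU_le => //; exact: f_meas. Qed.

Let closed_Phi_ge a : closed [set y | a <= Phi y].
Proof.
have -> : [set y | a <= Phi y] = Phi @^-1` [set r | a <= r] by [].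
by apply: closed_comp; [move=> y _; exact: Phi_cont | exact: closed_ge].
Qed.

Let closed_Phi_le a : closed [set y | Phi y <= a].
Proof.
have -> : [set y | Phi y <= a] = Phi @^-1` [set r | r <= a] by [].
by apply: closed_comp; [move=> y _; exact: Phi_cont | exact: closed_le].
Qed.

(* Slicing [C] by the values of [Phi], which is almost constant on a slice,
   replaces the usual covering of a compact set by small balls. *)
Let G_slices (s d : R) (k : nat) (C : set T) a c : 0 < d -> closed C ->
  (forall y, C y -> a <= Phi y <= a + k%:R * d) ->
  (forall y, C y -> (s%:E <= I0 y + (Phi y)%:E)%E) ->
  2 * d - s < c -> exp_le (G C) c.
Proof.
move=> d0; have slice (C' : set T) a' c' : closed C' ->
    (forall y, C' y -> a' <= Phi y <= a' + d) ->
    (forall y, C' y -> (s%:E <= I0 y + (Phi y)%:E)%E) ->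
    2 * d - s < c' -> exp_le (G C') c'.
  move=> clC' aC' sC' c's.
  (* On a slice [Phi y <= a' + d] forces [I0 y >= s - a' - d]; the level is taken lower by a further
     [d] to make the bound on the infimum strict, hence the total loss [2 * d]. *)
  apply: (@G_level C' a' (s - a' - 2 * d)) => //; last by lra.
    by move=> y /aC' /andP[].
  apply: (@lt_le_trans _ _ (s - a' - d)%:E); first by rewrite lte_fin; lra.
  apply: le_ereal_inf_tmp => _ [y C'y <-].
  have /andP[_ ya'] := aC' _ C'y; have := sC' _ C'y.
  by case: (I0 y) => [r| |]; rewrite ?leey// -EFinD !lee_fin; lra.
elim: k C a c => [|k IH] C a c clC aC sC cs.
  apply: (@slice C a) => // y Cy; have := aC _ Cy.
  by rewrite mul0r addr0 => /andP[-> /=]; lra.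
(* The lowest slice is split off; the pieces overlap where [Phi] equals [a + d], so that both are
   closed. *)
pose A := C `&` [set y | Phi y <= a + d].
pose B := C `&` [set y | a + d <= Phi y].
have CAB : C = A `|` B.
  rewrite -setIUr; apply/seteqP; split=> [y Cy|y []//]; split=> //=.
  by case: (leP (Phi y) (a + d)) => [|/ltW]; [left | right].
have clA : closed A by apply: closedI => //; exact: closed_Phi_le.
have clB : closed B by apply: closedI => //; exact: closed_Phi_ge.
pose c' := (c + (2 * d - s)) / 2.
apply: (@exp_le_trans _ _ (fun eps => G A eps + G B eps)%E).
  near=> eps; rewrite [in leLHS]CAB; apply: G_setU_le; [|exact: closed_borel..].
  by near: eps; exact: near0_gt0.
apply: (@exp_leD _ _ _ c'); first by rewrite /c'; lra.
- apply: (@slice A a) => //; last by rewrite /c'; lra.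
    by move=> y [Cy yad]; have /andP[-> _] := aC _ Cy.
  by move=> y [/sC].
- apply: (@IH B (a + d)) => //; last by rewrite /c'; lra.
    move=> y [Cy /= ->]; have /andP[_] := aC _ Cy.
    by rewrite -natr1 mulrDl mul1r; lra.
  by move=> y [/sC].
Unshelve. all: by end_near. Qed.

(** Meant for closed subsets of compact sets, where [Phi] is bounded: finitely many slices of width
    [d] then cover [C], and [d] is arbitrarily small. *)
Let G_compact (s M : R) (C : set T) c : closed C ->
  (forall y, C y -> `|Phi y| <= M) ->
  (forall y, C y -> (s%:E <= I0 y + (Phi y)%:E)%E) ->
  - s < c -> exp_le (G C) c.
Proof.
move=> clC CM sC cs.
(* Then [2 * d - s] is the midpoint of [- s] and [c], and [k] slices cover the interval from [- |M|]
   to [|M|]. The absolute value matters when [C] is empty and [M] negative. *)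
pose d := (c + s) / 4; have d0 : 0 < d by rewrite /d; lra.
pose k := (Num.trunc (2 * `|M| / d)).+1.
apply: (@G_slices s d k C (- `|M|)) => //; last by rewrite /d; lra.
move=> y /CM yM; have := le_trans yM (ler_norm M); rewrite ler_norml.
move=> /andP[-> yM' /=].
have : 2 * `|M| / d < k%:R by rewrite /k; exact: truncnS_gt.
by rewrite ltr_pdivrMr//; lra.
Qed.

(** On the part of [O] where [Phi < Phi y + d], an open set containing [y], and off the bad set, [V]
    is at most [Phi y + 2 * d]. Removing the bad set does not spoil the lower bound on the
    probability, because its rate can be made as small as desired. *)
Let G_open (O : set T) y r c : open O -> O y -> I0 y = r%:E ->
  c < - (r + Phi y) -> exp_ge (G O) c.
Proof.
move=> oO Oy I0y cr.
(* A quarter of the gap: [2 * d] is lost on [V] and [2 * d] on the probability, which ends exactly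
   at [c]. *)
pose d := (- (r + Phi y) - c) / 4; have d0 : 0 < d by rewrite /d; lra.
pose O' : set (borel T) := O `&` [set z | Phi z < Phi y + d].
have oO' : open (O' : set T).
  apply: openI => //.
  have -> : [set z | Phi z < Phi y + d] = Phi @^-1` [set t | t < Phi y + d].
    by [].
  by apply: open_comp; [move=> z _; exact: Phi_cont | exact: open_lt].
have mO := open_borel oO; have mO' := open_borel oO'.
have [_ _ Pop] := P_ldp.
have PO' : exp_ge (fun eps => P eps O') (- r - d).
  apply: limf_einf_exp_ge => //; apply: lt_le_trans (Pop _ oO').
  apply: (@lt_le_trans _ _ (- r%:E)%E); first by rewrite -EFinN lte_fin; lra.
  rewrite leeN2 -I0y; apply: ereal_inf_lbound; exists y => //.
  by split => //=; rewrite ltrDl.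
have Pb := @P_bad d (- r - 2 * d) d0.
have h : exp_ge (fun eps => P eps O' - P eps (bad d eps))%E (- r - 2 * d).
  by apply: (exp_ge_subr PO' Pb); lra.
have {h} := exp_geM (- (Phi y + 2 * d)) h.
rewrite (_ : - (Phi y + 2 * d) + (- r - 2 * d) = c); last by rewrite /d; lra.
apply: exp_ge_trans; near=> eps.
have e0 : 0 < eps by near: eps; exact: near0_gt0.
have e2 : 0 < eps ^+ 2 by rewrite exprn_gt0.
have mb := bad_meas d e0.
have mO'b : measurable (O' `\` bad d eps) by exact: measurableD.
apply: (@le_trans _ _
  ((expR (- (Phi y + 2 * d) / eps ^+ 2))%:E * P eps (O' `\` bad d eps))%E).
  rewrite lee_wpmul2l ?lee_fin ?expR_ge0// leeBlDr ?fin_num_measure//.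
  apply: (@le_trans _ _ (P eps ((O' `\` bad d eps) `|` bad d eps))).
    rewrite le_measure ?inE//; first exact: measurableU.
    by move=> z O'z; have [bz|bz] := pselect (bad d eps z); [right | left].
  exact: measureU2.
apply: (@le_trans _ _ (G (O' `\` bad d eps) eps)).
  apply: ge0_integral_ge_cst => //; first exact: f_meas.
  move=> z [[Oz /= zy] /negP]; rewrite -leNgt lee_fin ler_expR -mulNr => Vd.
  rewrite ler_pM2r ?invr_gt0//.
  by have := ler_norm (V eps z - Phi z); lra.
apply: ge0_subset_integral => //.
- by apply: measurable_funTS; exact: f_meas.
- by move=> z [[]].
Unshelve. all: by end_near. Qed.

(** * The normalized measures and their rate function *)

Hypothesis T_hausdorff : hausdorff_space T.
Hypothesis Z_fin : forall eps, 0 < eps ->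
  (normalizing_constant (P eps) (V eps : borel T -> R) eps < +oo)%E.
Variable Q : R -> probability (borel T) R.
Hypothesis Q_def : forall eps, 0 < eps ->
  forall A : set (borel T), measurable A ->
  Q eps A = tilted (P eps) (V eps : borel T -> R) eps A.
Hypothesis Q_tight : exponentially_tight Q.

Let Z eps := G setT eps.

Let ZE eps : normalizing_constant (P eps) (V eps : borel T -> R) eps = Z eps.
Proof. by rewrite /normalizing_constant unlock. Qed.

(** A zero constant would give [Q eps] total mass 0 instead of 1. *)
Let Z_gt0 eps : 0 < eps -> exists2 z : R, 0 < z & Z eps = z%:E.
Proof.
move=> e0; have := Q_def e0 measurableT; have := Z_fin e0.
rewrite /tilted ZE -[(\int[_]_(_ in setT) _)%E]/(Z eps) probability_setT.
have : (0 <= Z eps)%E by apply: integral_ge0.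
case: (Z eps) => [z| |]//; rewrite lee_fin => z0 _ z1; exists z => //.
rewrite lt_neqAle z0 andbT; apply/negP => /eqP zE.
by move: z1; rewrite -zE mule0 => /eqP; rewrite onee_eq0.
Qed.

Let ZQ eps (A : set (borel T)) : 0 < eps -> measurable A ->
  (Z eps * Q eps A)%E = G A eps.
Proof.
move=> e0 mA; rewrite (Q_def e0 mA) /tilted ZE.
have [z z0 ->] := Z_gt0 e0.
by rewrite muleA -EFinM divff ?gt_eqF// mul1e.
Qed.

Let compact_borel (K : set T) : compact K -> measurable (K : set (borel T)).
Proof. by move=> cK; apply: closed_borel; exact: compact_closed. Qed.

(** Tightness of [Q] at level 1 leaves at most mass 1/2 outside [K] for small [eps], so at least
    half of [Z] comes from [K]. This replaces a lower bound on [Phi] over the whole space. *)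
Let Z_le_compact : exists2 K : set T, compact K &
  \forall eps \near 0^'+, (Z eps <= 2%:E * G K eps)%E.
Proof.
have [K cK /limf_esup_exp_le QK] := Q_tight 1; exists K => //.
have mK := compact_borel cK.
near=> eps.
have e0 : 0 < eps by near: eps; exact: near0_gt0.
have [z z0 Zz] := Z_gt0 e0.
rewrite -(ZQ e0 mK) muleCA -[leLHS]mule1 Zz lee_pmul2l//.
have Kc : (Q eps (~` K) <= (2^-1)%:E)%E.
  apply: (@le_trans _ _ (expR (- 1 / eps ^+ 2))%:E).
    by near: eps; exact: QK.
  rewrite lee_fin mulNr expRN lef_pV2 ?posrE ?expR_gt0//.
  by near: eps; apply: near0_expR_ge.
have mKc : measurable (~` K : set (borel T)) by exact: measurableC.
move: Kc; rewrite probability_setC//.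
have : Q eps K \is a fin_num by exact: fin_num_measure.
by case: (Q eps K) => // q _; rewrite -EFinB -EFinM !lee_fin; lra.
Unshelve. all: by end_near. Qed.

Let Z_exp_le (s c : R) : (forall y, s%:E <= I0 y + (Phi y)%:E)%E ->
  - s < c -> exp_le Z c.
Proof.
move=> sI sc; have [K cK] := Z_le_compact.
move/exp_le_trans; apply; pose c' := (c - s) / 2.
apply: (@exp_leZ _ _ _ c') => //; first by rewrite /c'; lra.
have [M KM] := continuous_bounded_on Phi_cont cK.
apply: (@G_compact s M) => //; last by rewrite /c'; lra.
exact: compact_closed.
Qed.

(** If [I0] were at least 1 everywhere, the upper bound on the whole space would contradict total
    mass 1. *)
Let I0_fin : exists y, exists r, I0 y = r%:E.
Proof.
have [_ /(_ _ closedT) Pcl _] := P_ldp.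
have /ereal_inf_lt[_ [y _ <-] Iy] : (ereal_inf (I0 @` setT) < 1)%E.
  rewrite ltNge; apply/negP => I1.
  have : exp_le (fun eps => P eps setT) (- 2^-1).
    apply: limf_esup_exp_le => //; apply: le_lt_trans Pcl _.
    rewrite EFinN lteN2; apply: lt_le_trans I1.
    by rewrite lte_fin; lra.
  have : exp_ge (fun eps => P eps setT) 0.
    by apply: nearW => eps; rewrite probability_setT mul0r expR0.
  by move=> /exp_ge_le /[apply]; lra.
exists y; move: Iy; have := I0_ge0 y.
by case: (I0 y) => // r _ _; exists r.
Qed.

Let m := ereal_inf [set ((Phi z)%:E + I0 z)%E | z in [set: T]].

Let m_le y : (m <= I0 y + (Phi y)%:E)%E.
Proof. by rewrite addeC; apply: ereal_inf_lbound; exists y. Qed.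

(** A point where [I0] is finite bounds [m] above. Below, [Z] has a finite exponential upper rate by
    reduction to a compact set, whereas by [G_open] every value of [I0 + Phi] gives [Z] a lower rate
    close to its opposite. *)
Let m_fin : m \is a fin_num.
Proof.
rewrite fin_numE; apply/andP; split; last first.
  have [y [r I0y]] := I0_fin; rewrite -ltey (le_lt_trans (m_le y))//.
  by rewrite I0y ltry.
have [K cK ZK] := Z_le_compact.
have [M KM] := continuous_bounded_on Phi_cont cK.
(* On [K], [I0 + Phi >= - M]; one unit is spent on the strict inequality of [G_compact] and one on
   the factor 2. *)
have Zle : exp_le Z (M + 2).
  apply: exp_le_trans ZK _; apply: (@exp_leZ _ _ _ (M + 1)); [by []|by lra|].
  apply: (@G_compact (- M) M) => //; [exact: compact_closed| |by lra].
  move=> y /KM; rewrite ler_norml => /andP[My _]; have := I0_ge0 y.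
  by case: (I0 y) => [r| |]; rewrite ?leey// -EFinD !lee_fin; lra.
rewrite -ltNye; apply: (@lt_le_trans _ _ (- M - 3)%:E); first exact: ltNyr.
apply: le_ereal_inf_tmp => _ [y _ <-]; have := I0_ge0 y.
case Iy : (I0 y) => [r| |]; rewrite ?addey ?leey// -EFinD !lee_fin => r0.
have ry : - (r + Phi y) - 2^-1 < - (r + Phi y) by lra.
by have := exp_ge_le (@G_open setT y r _ openT I Iy ry) Zle; lra.
Qed.

Let Z_le c : - fine m < c -> exp_le Z c.
Proof. by move=> mc; apply: (@Z_exp_le (fine m)) => // y; rewrite fineK. Qed.

Let Z_ge c : c < - fine m -> exp_ge Z c.
Proof.
move=> cm; have : (m < (- c)%:E)%E by rewrite -(fineK m_fin) lte_fin; lra.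
move=> /ereal_inf_lt[_ [y _ <-]]; have := I0_ge0 y.
case Iy : (I0 y) => [r| |]// r0; rewrite -EFinD lte_fin => yc.
by apply: (@G_open setT y r c openT I Iy); lra.
Qed.

Let I y := (I0 y + (Phi y)%:E - m)%E.

Let Q_closed (C : set T) c : closed C -> (- ereal_inf (I @` C) < c%:E)%E ->
  exp_le (fun eps => Q eps C) c.
Proof.
move=> clC; rewrite lteNl -EFinN => cI.
have mC := closed_borel clC.
(* The slack [e] is shared out: [e / 4] for the strict bound on the integral over [C] and [K],
   [e / 4] for [Z], and [e / 2] for adding the complement of [K], whose rate is [c - e]. *)
have [e e0 cIe] : exists2 e : R, 0 < e & ((- c + e)%:E < ereal_inf (I @` C))%E.
  move: cI; case: (ereal_inf _) => [i| |]// ci.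
  - exists ((i + c) / 2); rewrite ?lte_fin in ci *; lra.
  - by exists 1; rewrite ?ltry.
have [K cK /limf_esup_exp_le QK] := Q_tight (- c + e).
have mK := compact_borel cK.
have [M KM] := continuous_bounded_on Phi_cont cK.
have clCK : closed (C `&` K) by apply: closedI => //; exact: compact_closed.
have GCK : exp_le (G (C `&` K)) (c - e / 2 - e / 4 - fine m).
  apply: (@G_compact (- c + e + fine m) M) => //; last by lra.
    by move=> y [_ /KM].
  move=> y [Cy _]; have : ((- c + e)%:E <= I y)%E.
    by apply: le_trans (ltW cIe) _; apply: ereal_inf_lbound; exists y.
  by rewrite /I EFinD -{1}(fineK m_fin) leeBrDr.
have QCK : exp_le (fun eps => Q eps (C `&` K)) (c - e / 2).
  have Zm : exp_ge Z (- e / 4 - fine m) by apply: Z_ge; lra.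
  have := exp_le_div _ _ GCK Zm.
  rewrite (_ : _ - _ - (_ - _) = c - e / 2); last by field.
  apply => //; near=> eps.
  have eps0 : 0 < eps by near: eps; exact: near0_gt0.
  by rewrite ZQ//; exact: closed_borel.
apply: (@exp_le_trans _ _ (fun eps => Q eps (C `&` K) + Q eps (~` K))%E).
  near=> eps; apply: (@le_trans _ _ (Q eps ((C `&` K) `|` ~` K))).
    rewrite le_measure ?inE//.
      by apply: measurableU; [exact: measurableI | exact: measurableC].
    by move=> y Cy; have [Ky|Ky] := pselect (K y); [left | right].
  by apply: measureU2; [exact: measurableI | exact: measurableC].
apply: (@exp_leD _ _ _ (c - e / 2)) => //; first by lra.
by apply: exp_leW (QK _) => //; lra.
Unshelve. all: by end_near. Qed.

Let Q_open (O : set T) y c : open O -> O y -> (I y < (- c)%:E)%E ->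
  exp_ge (fun eps => Q eps O) c.
Proof.
move=> oO Oy; rewrite /I -{1}(fineK m_fin); have := I0_ge0 y.
case Iy : (I0 y) => [r| |]// r0; rewrite -!EFinD lte_fin => yc.
(* Half of this gap goes to the integral over [O], half to the normalizing constant. *)
pose e := - c - (r + Phi y - fine m).
have GO : exp_ge (G O) (- (r + Phi y) - e / 2).
  by apply: (@G_open O y r) => //; rewrite /e; lra.
have Zm : exp_le Z (e / 2 - fine m) by apply: Z_le; rewrite /e; lra.
have := exp_ge_div _ _ GO Zm.
rewrite (_ : _ - _ - (_ - _) = c); last by rewrite /e; field.
apply => //; near=> eps.
have eps0 : 0 < eps by near: eps; exact: near0_gt0.
by rewrite ZQ//; exact: open_borel.
Unshelve. all: by end_near. Qed.

Let I_lsc : lower_semicontinuous I.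
Proof.
have [I0_lsc _ _] := P_ldp => x a; rewrite /I -{1}(fineK m_fin).
have key y e : 0 < e -> `|Phi x - Phi y| < e ->
  ((a + fine m - Phi x + e)%:E < I0 y)%E -> (a%:E < I0 y + (Phi y)%:E - m)%E.
  move=> e0; rewrite ltr_norml => /andP[_ xy]; rewrite -(fineK m_fin).
  by case: (I0 y) => [r| |]//; rewrite ?ltry// -!EFinD !lte_fin; lra.
have near_Phi e : 0 < e -> \forall y \near x, `|Phi x - Phi y| < e.
  by move=> e0; have /cvgrPdist_lt := @Phi_cont x; apply.
have conc e : 0 < e -> ((a + fine m - Phi x + e)%:E < I0 x)%E ->
    exists2 W : set T, nbhs x W & forall y, W y -> (a%:E < I0 y + (Phi y)%:E - m)%E.
  move=> e0 /I0_lsc[W Wx WI]; exists (W `&` [set y | `|Phi x - Phi y| < e]).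
    by apply: filterI => //; exact: near_Phi.
  by move=> y [/WI Wy xy]; exact: key e0 xy Wy.
case Ix : (I0 x) => [r| |]//.
- rewrite -!EFinD lte_fin => ar.
  (* Half of the slack [I x - a] is left to the variation of [Phi], half to that of [I0]. *)
  by apply: (conc ((r + Phi x - fine m - a) / 2)); rewrite ?Ix ?lte_fin; lra.
- by move=> _; apply: (conc 1) => //; rewrite Ix ltry.
Qed.

Lemma tilted_ldp :
  let I := fun y => (I0 y + (Phi y)%:E
    - ereal_inf [set (Phi z)%:E + I0 z | z in [set: T]])%E in
  ldp Q I /\ good_rate_function I.
Proof.
change (ldp Q I /\ good_rate_function I).
split; first split=> [|C clC|O oO]; first exact: I_lsc.
- apply: lee_gt_EFin => c /(Q_closed clC); exact: exp_le_limf_esup.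
- apply: lee_lt_EFin => c; rewrite lteNr -EFinN => /ereal_inf_lt[_ [y Oy <-]] yc.
  by apply: exp_ge_limf_einf => //; exact: Q_open yc.
(* The sublevel set lies in [K]: a point outside with [I y <= t] would give the complement of [K] a
   lower rate [- t - 1/2], against the upper rate [- (t + 1)] from tightness. *)
move=> t; have [K cK /limf_esup_exp_le QK] := Q_tight (t + 1).
have clI : closed [set y | (I y <= t%:E)%E].
  rewrite -openC; have /lower_semicontinuousP/(_ t) := I_lsc; congr open.
  by apply/seteqP; split=> y /=; rewrite ltNge => /negP.
apply: (subclosed_compact clI cK) => y /= Iyt; apply: contrapT => Ky.
have oK : open (~` K) by rewrite openC; exact: compact_closed.
have /(Q_open oK Ky)/exp_ge_le/(_ (QK _)) : (I y < (- (- t - 2^-1))%:E)%E.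
  by apply: le_lt_trans Iyt _; rewrite lte_fin; lra.
by move=> /(_ (fun=> measure_ge0 _ _)); lra.
Qed.

End tilting_ldp.

Lemma exp_le_sum (R : realType) (n : nat) (f : 'I_n -> R -> \bar R) a c :
  a < c -> (forall i, exp_le (f i) a) ->
  exp_le (fun eps => \sum_(i < n) f i eps)%E c.
Proof.
move=> ac fa.
have : exp_le (fun eps => n%:R%:E * (expR (a / eps ^+ 2))%:E)%E c.
  by apply: exp_leZ ac _; [exact: ler0n | exact: nearW].
apply: exp_le_trans.
have : \forall eps \near (0 : R)^'+, forall i,
    (f i eps <= (expR (a / eps ^+ 2))%:E)%E by exact: filter_forall.
apply: filterS => eps faeps.
apply: le_trans (lee_sum _ (fun i _ => faeps i)) _.
by rewrite sumEFin -EFinM lee_fin sumr_const card_ord mulr_natl.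
Qed.

(** * From the expansion and exponential moments to superexponential closeness *)

Section expansion.
Context {R : realType} {d : measure_display} {T : measurableType d}.
Variables (P : R -> probability T R) (n : nat).
Variables (Feps : R -> T -> R) (F : 'I_n.+1 -> T -> R) (Rn : R -> T -> R).
Hypothesis n_ge1 : (1 <= n)%N.
Hypothesis F_meas : forall i, measurable_fun [set: T] (F i).
Hypothesis Rn_meas : forall eps, 0 < eps -> measurable_fun [set: T] (Rn eps).
Hypothesis Feps_expansion : forall (eps : R) (y : T), 0 < eps ->
  Feps eps y =
    \sum_(i < n.+1) eps ^+ i / (i`!)%:R * F i y + eps ^+ n * Rn eps y.
Hypothesis exp_moments : forall i : 'I_n.+1, exists2 gamma : R, 0 < gamma &
  (limf_esup (fun eps : R => (eps ^+ 2)%:E *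
     lne ('E_(P eps)[fun y : T =>
       expR (gamma * (Num.max `|F i y| `|Rn eps y| / eps ^+ 2))%R]))
     (0 : R)^'+ < +oo)%E.

Lemma expansion_measurable eps : 0 < eps -> measurable_fun [set: T] (Feps eps).
Proof.
move=> e0; rewrite (_ : Feps eps = fun y =>
    \sum_(i < n.+1) eps ^+ i / (i`!)%:R * F i y + eps ^+ n * Rn eps y); last first.
  by apply/funext => y; exact: Feps_expansion.
apply: measurable_funD.
  by apply: measurable_sum => i; apply: measurable_funM.
by apply: measurable_funM => //; exact: Rn_meas.
Qed.

Let W i eps y := Num.max `|F i y| `|Rn eps y|.

(** Once [F ord0] cancels, every remaining term carries a positive power of [eps], the remainder
    because [n >= 1]; for [eps <= 1] this power is at most [eps]. *)
Lemma expansion_dist_le eps y : 0 < eps <= 1 ->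
  `|Feps eps y - F ord0 y| <= eps * \sum_(i < n.+1) W i eps y.
Proof.
move=> /andP[e0 e1]; have ege0 := ltW e0; rewrite Feps_expansion//.
rewrite big_ord_recl expr0 fact0 invr1.
rewrite !mul1r; set S := \sum_(i < n) _; set X := eps ^+ n * _.
have -> : F ord0 y + S + X - F ord0 y = X + S by ring.
(* The summand of index 0, freed by the cancellation of [F ord0], dominates the remainder; each
   later one dominates the term of its own order. *)
rewrite big_ord_recl mulrDr.
apply: le_trans (ler_normD _ _) _; apply: lerD.
  rewrite normrM; apply: ler_pM => //; last by rewrite le_max lexx orbT.
  by rewrite ger0_norm ?exprn_ge0// ler_iXnr.
rewrite mulr_sumr; apply: le_trans (ler_norm_sum _ _ _) _.
apply: ler_sum => i _; rewrite normrM; apply: ler_pM => //.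
  rewrite ger0_norm ?divr_ge0 ?exprn_ge0//.
  apply: (@le_trans _ _ (eps ^+ lift ord0 i)); last by rewrite ler_iXnr.
  rewrite ler_pdivrMr ?ltr0n ?fact_gt0// ler_peMr ?exprn_ge0//.
  by rewrite ler1n fact_gt0.
by rewrite le_max lexx.
Qed.

Lemma expansion_exp_approx (delta L : R) : 0 < delta ->
  exp_le (fun eps =>
    \int[P eps]_(y in [set y | (delta < `|Feps eps y - F ord0 y|)%R])
    (expR (`|Feps eps y - F ord0 y| / eps ^+ 2))%:E)%E L.
Proof.
move=> delta0.
(* The pair [g i] consists of the exponent [gamma] and a real rate for the corresponding exponential
   moment. *)
have /choice[g gP] : forall i, exists gC : R * R, 0 < gC.1 /\
    exp_le (fun eps =>
      'E_(P eps)[fun y => expR (gC.1 * (W i eps y / eps ^+ 2))%R])%E gC.2.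
  move=> i; have [gamma gamma0 lim_lt] := exp_moments i.
  have [C limC] : exists C : R, (limf_esup (fun eps : R => (eps ^+ 2)%:E *
     lne ('E_(P eps)[fun y : T => expR (gamma * (W i eps y / eps ^+ 2))%R]))
     (0 : R)^'+ < C%:E)%E.
    move: lim_lt; rewrite /W; case: (limf_esup _ _) => [r _| |_]//.
      by exists (r + 1); rewrite lte_fin ltrDl.
    by exists 0; rewrite ltNyr.
  exists (gamma, C); split => //; apply: limf_esup_exp_le limC => eps.
  by apply: expectation_ge0 => y; exact: expR_ge0.
(* The factor [expR (- K i / eps ^+ 2)] brings the moment of index [i] down to rate [L - 1], and the
   last unit pays for summing over [i]. *)
pose K i := (g i).2 - L + 1.
have W_meas i eps : 0 < eps -> measurable_fun [set: T] (W i eps).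
  move=> e0; apply: measurable_maxr.
    by apply: measurableT_comp; [exact: normr_measurable | exact: F_meas].
  by apply: measurableT_comp; [exact: normr_measurable | exact: Rn_meas].
have eW_meas i eps : 0 < eps -> measurable_fun [set: T]
    (fun y => (expR ((g i).1 * (W i eps y / eps ^+ 2)))%:E).
  move=> e0; apply/measurable_EFinP; apply: measurableT_comp => //.
  by apply: measurable_funM => //; apply: measurable_funM => //; exact: W_meas.
have h : exp_le (fun eps => \sum_(i < n.+1) ((expR (- K i / eps ^+ 2))%:E *
    'E_(P eps)[fun y => expR ((g i).1 * (W i eps y / eps ^+ 2))%R]))%E L.
  apply: (@exp_le_sum _ _ _ (L - 1)); first by lra.
  move=> i; have [_ /(exp_leM (- K i))] := gP i.
  by apply: exp_leW; rewrite /K; lra.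
apply: exp_le_trans h; pose N : R := n.+1%:R.
have N0 : 0 < N by rewrite /N ltr0n.
(* On the bad set, with [W i] maximal, these two bounds show that the distance and [|K i|] are each
   at most [(g i).1 / 2 * W i eps y]; the second uses [delta < N * eps * W i eps y]. Hence the
   distance is at most [- K i + (g i).1 * W i eps y]. *)
have small : \forall eps \near (0 : R)^'+, forall i,
    N * eps <= (g i).1 / 2 /\ N * eps * `|K i| <= delta * ((g i).1 / 2).
  apply: filter_forall => i; have [g0 _] := gP i.
  have K0 : 0 < `|K i| + 1 by rewrite ltr_wpDl.
  near=> eps.
  have e0 : 0 < eps by near: eps; exact: near0_gt0.
  have e1 : eps <= (g i).1 / 2 / N.
    by near: eps; apply: nbhs_right_ltW; rewrite !divr_gt0.
  have e2 : eps <= delta * ((g i).1 / 2) / (N * (`|K i| + 1)).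
    near: eps; apply: nbhs_right_ltW; apply: divr_gt0; last exact: mulr_gt0.
    by rewrite mulr_gt0// divr_gt0.
  split; first by rewrite mulrC -ler_pdivlMr.
  move: e2; rewrite ler_pdivlMr ?mulr_gt0//; apply: le_trans.
  by rewrite (mulrC N) -mulrA ler_pM2l// ler_pM2l// lerDl.
near=> eps.
have e0 : 0 < eps by near: eps; exact: near0_gt0.
have e01 : 0 < eps <= 1 by rewrite e0; near: eps; exact: nbhs_right_ltW.
have sm : forall i,
    N * eps <= (g i).1 / 2 /\ N * eps * `|K i| <= delta * ((g i).1 / 2).
  by near: eps.
have e2 : 0 < eps ^+ 2 by rewrite exprn_gt0.
pose t i (y : T) := ((expR (- K i / eps ^+ 2))%:E *
  (expR ((g i).1 * (W i eps y / eps ^+ 2)))%:E)%E.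
have t_ge0 i y : (0 <= t i y)%E by rewrite /t -EFinM lee_fin mulr_ge0 ?expR_ge0.
have t_meas i : measurable_fun setT (t i).
  by apply: measurable_funeM; exact: eW_meas.
have -> : (\sum_(i < n.+1) ((expR (- K i / eps ^+ 2))%:E *
    'E_(P eps)[fun y => expR ((g i).1 * (W i eps y / eps ^+ 2))%R]) =
    \int[P eps]_y \sum_(i < n.+1) t i y)%E.
  rewrite ge0_integral_sum//; apply: eq_bigr => i _.
  by rewrite unlock ge0_integralZl//; exact: eW_meas.
have dist_meas : measurable_fun [set: T] (fun y => `|Feps eps y - F ord0 y|).
  apply: measurableT_comp; first exact: normr_measurable.
  by apply: measurable_funB => //; exact: expansion_measurable.
have mb := measurable_superlevel delta dist_meas.
have sum_meas : measurable_fun setT (fun y => \sum_(i < n.+1) t i y)%E.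
  exact: emeasurable_sum.
apply: (@le_trans _ _
  (\int[P eps]_(y in [set y | (delta < `|Feps eps y - F ord0 y|)%R])
    \sum_(i < n.+1) t i y)%E); last first.
  by apply: ge0_subset_integral => // y _; exact: sume_ge0.
apply: ge0_le_integral => //.
- apply: measurable_funTS; apply/measurable_EFinP; apply: measurableT_comp => //.
  by apply: measurable_funM.
- exact: measurable_funTS.
move=> y /= bady.
(* The index of the largest [W] depends on [y], which is why the integrand is dominated by the sum
   of all [t i]. *)
have [i Wi] : exists i, `|Feps eps y - F ord0 y| <= N * eps * W i eps y.
  have [i _ imax] := @arg_maxP _ _ _ ord0 xpredT (fun i => W i eps y) isT.
  exists i; apply: le_trans (expansion_dist_le y e01) _.
  rewrite (mulrC N) -mulrA ler_pM2l//.
  apply: le_trans (ler_sum _ (G := fun=> W i eps y) _) _.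
    by move=> j _; exact: imax.
  by rewrite sumr_const card_ord mulr_natl.
apply: (@le_trans _ _ (t i y)); last first.
  by rewrite (bigD1 i)//= leeDl// sume_ge0.
have [smi smK] := sm i; have [g0 _] := gP i.
rewrite /t -EFinM lee_fin -expRD ler_expR mulrA -mulrDl ler_pM2r ?invr_gt0//.
have W0 : 0 <= W i eps y by rewrite le_max normr_ge0.
have Ne0 : 0 < N * eps by rewrite mulr_gt0.
have dW : delta < N * eps * W i eps y by exact: lt_le_trans Wi.
have WK : `|K i| <= (g i).1 / 2 * W i eps y.
  rewrite -(ler_pM2l Ne0); apply: le_trans smK _.
  by rewrite [leRHS]mulrCA [leRHS]mulrC ler_pM2r ?divr_gt0// ltW.
have := ler_wpM2r W0 smi; have := ler_norm (K i); lra.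
Unshelve. all: by end_near. Qed.

End expansion.

Theorem lemma3p2 (R : realType) (B : completeNormedModType R)
  (mu0 : R -> probability (borel B) R) (I0 : B -> \bar R)
  (mu0_tight : exponentially_tight mu0)
  (I0_ge0 : forall y, (0 <= I0 y)%E)
  (mu0_ldp : ldp mu0 I0)
  (I0_good : good_rate_function I0)
  (n : nat) (n_ge1 : (1 <= n)%N)
  (Feps : R -> B -> R) (F : 'I_n.+1 -> B -> R) (Rn : R -> B -> R)
  (F_meas : forall i, measurable_fun [set: borel B] (F i : borel B -> R))
  (Rn_meas : forall eps : R, 0 < eps ->
     measurable_fun [set: borel B] (Rn eps : borel B -> R))
  (Feps_expansion : forall (eps : R) (y : B), 0 < eps ->
     Feps eps y =
       \sum_(i < n.+1) eps ^+ i / (i`!)%:R * F i y + eps ^+ n * Rn eps y)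
  (Rn_cvg0 : forall y : B, Rn eps y @[eps --> (0 : R)^'+] --> (0 : R))
  (F0_cont : continuous (F ord0))
  (exp_moments : forall i : 'I_n.+1, exists2 gamma : R, 0 < gamma &
     (limf_esup (fun eps : R => (eps ^+ 2)%:E *
        lne ('E_(mu0 eps)[fun y : borel B =>
          expR (gamma * (Num.max `|F i y| `|Rn eps y| / eps ^+ 2))%R]))
        (0 : R)^'+ < +oo)%E)
  (Z_fin : forall eps : R, 0 < eps ->
     (normalizing_constant (mu0 eps) (Feps eps) eps < +oo)%E)
  (mu : R -> probability (borel B) R)
  (mu_def : forall eps : R, 0 < eps -> forall A : set (borel B), measurable A ->
     mu eps A = tilted (mu0 eps) (Feps eps) eps A)
  (mu_tight : exponentially_tight mu) :
  let I := fun y : B =>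
    (I0 y + (F ord0 y)%:E
     - ereal_inf [set (F ord0 z)%:E + I0 z | z in [set: B]])%E in
  ldp mu I /\ good_rate_function I.
Proof.
apply: (tilted_ldp I0_ge0 mu0_ldp F0_cont _ _ _ Z_fin mu_def mu_tight).
- exact: (expansion_measurable F_meas Rn_meas Feps_expansion).
- exact: (expansion_exp_approx n_ge1 F_meas Rn_meas Feps_expansion exp_moments).
- exact: norm_hausdorff.
Qed.
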